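(* Let $X_1$ and $X_2$ be proper $\mathrm{CAT}(0)$ spaces, let $\Gamma$ be an abstract group acting properly discontinuously by isometries on $X_1$ and on $X_2$, and let $\rho_i:\Gamma\to \mathrm{Isom}(X_i)$, $i=1,2$, denote the induced homomorphisms. Suppose that there exists $\alpha\in\Gamma$ such that $\rho_i(\alpha)$ is a rank one isometry of $X_i$ for both $i=1,2$. If the diagonal action of $\Gamma$ on $X_1\times X_2$ given by $\rho=(\rho_1,\rho_2)$, $\rho(\gamma)=(\rho_1(\gamma),\rho_2(\gamma))$, is convex co-compact, then $\rho_1$ and $\rho_2$ have the same marked length spectrum up to scaling, i.e. there exists $\lambda>0$ such that $\ell(\rho_1(\gamma))=\lambda\,\ell(\rho_2(\gamma))$ for all $\gamma\in\Gamma$.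
   Context: $X_1\times X_2$ carries the product metric $d=\sqrt{d_1^2+d_2^2}$. A properly discontinuous isometric action of a group on a proper CAT(0) space $X$ is convex co-compact if there is a nonempty closed invariant convex subset $C\subset X$ with $C/\Gamma$ compact. For an isometry $g$ of $X$, the translation length is $\ell(g)=\inf_{x\in X} d(x,gx)$. An isometry $g$ is hyperbolic if $x\mapsto d(x,gx)$ attains its infimum and $g$ has no fixed point; then $g$ has an axis, a $g$-invariant complete geodesic line on which $d(x,gx)$ is minimal. A hyperbolic isometry $g$ is rank one if an axis $l_g$ has the contraction property: there is $K>0$ such that the nearest-point projection to $l_g$ of any metric ball in $X$ disjoint from $l_g$ has diameter at most $K$ (equivalently, $l_g$ does not bound a flat half-plane). *)

(* Defs.v *)
From HB Require Import structures.
From mathcomp Require Import all_boot all_order all_algebra.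
From mathcomp Require Import boolp classical_sets reals.
Set Implicit Arguments. Unset Strict Implicit. Unset Printing Implicit Defensive.
Import Order.TTheory GRing.Theory Num.Theory.
Local Open Scope classical_set_scope.
Local Open Scope ring_scope.

Section Metric.
Context {R : realType} {T : Type} (d : T -> T -> R).

Definition is_metric : Prop :=
  [/\ (forall x y, 0 <= d x y), (forall x y, d x y = 0 <-> x = y),
      (forall x y, d x y = d y x) & (forall x y z, d x z <= d x y + d y z)].

Definition mball (x : T) (r : R) : set T := [set y | d x y < r].
Definition mcball (x : T) (r : R) : set T := [set y | d x y <= r].

Definition mopen (U : set T) : Prop :=
  forall x, U x -> exists e, 0 < e /\ mball x e `<=` U.
Definition mclosed (F : set T) : Prop := mopen (~` F).

Definition mcompact (K : set T) : Prop :=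
  forall (I : Type) (U : I -> set T), (forall i, mopen (U i)) ->
    (forall x, K x -> exists i, U i x) ->
    exists n (f : 'I_n -> I), forall x, K x -> exists k, U (f k) x.

Definition proper_space : Prop := forall x r, mcompact (mcball x r).

Definition geodesic (c : R -> T) (x y : T) : Prop :=
  [/\ c 0 = x, c (d x y) = y &
      forall s t, 0 <= s <= d x y -> 0 <= t <= d x y -> d (c s) (c t) = `|s - t|].

Definition geodesic_space : Prop := forall x y, exists c, geodesic c x y.

Definition isometry (f : T -> T) : Prop := forall x y, d (f x) (f y) = d x y.

End Metric.

Definition eucl {R : realType} (p q : R * R) : R :=
  Num.sqrt ((p.1 - q.1) ^+ 2 + (p.2 - q.2) ^+ 2).

Definition seg_pt {R : realType} (a b : R * R) (t : R) : R * R :=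
  (a.1 + t / eucl a b * (b.1 - a.1), a.2 + t / eucl a b * (b.2 - a.2)).

(* pairs (point on side [x,y] of the geodesic triangle, its comparison point) *)
Definition side {R : realType} {T : Type} (d : T -> T -> R) (c : R -> T)
  (x y : T) (a b : R * R) : set (T * (R * R)) :=
  [set pq | exists t, 0 <= t <= d x y /\ pq = (c t, seg_pt a b t)].

Definition CAT0_ineq {R : realType} {T : Type} (d : T -> T -> R) : Prop :=
  forall (x y z : T) (cxy cyz czx : R -> T) (a b c : R * R),
    geodesic d cxy x y -> geodesic d cyz y z -> geodesic d czx z x ->
    eucl a b = d x y -> eucl b c = d y z -> eucl c a = d z x ->
    let S := side d cxy x y a b `|` side d cyz y z b c `|` side d czx z x c a in
    forall p q, S p -> S q -> d p.1 q.1 <= eucl p.2 q.2.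

Definition CAT0 {R : realType} {T : Type} (d : T -> T -> R) : Prop :=
  [/\ is_metric d, geodesic_space d & CAT0_ineq d].

Definition proper_CAT0 {R : realType} {T : Type} (d : T -> T -> R) : Prop :=
  CAT0 d /\ proper_space d.

Definition prod_dist {R : realType} {T1 T2 : Type} (d1 : T1 -> T1 -> R)
  (d2 : T2 -> T2 -> R) (p q : T1 * T2) : R :=
  Num.sqrt (d1 p.1 q.1 ^+ 2 + d2 p.2 q.2 ^+ 2).

Definition is_group {G : Type} (mul : G -> G -> G) (inv : G -> G) (one : G) : Prop :=
  [/\ (forall a b c, mul a (mul b c) = mul (mul a b) c),
      (forall a, mul one a = a /\ mul a one = a) &
      (forall a, mul (inv a) a = one /\ mul a (inv a) = one)].

Definition isometric_action {R : realType} {G T : Type} (mul : G -> G -> G) (one : G)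
  (d : T -> T -> R) (rho : G -> T -> T) : Prop :=
  [/\ (forall g h x, rho (mul g h) x = rho g (rho h x)),
      (forall x, rho one x = x) & (forall g, isometry d (rho g))].

Definition finite_subset {G : Type} (P : set G) : Prop :=
  exists n (f : 'I_n -> G), forall g, P g -> exists k, g = f k.

Definition properly_discontinuous {R : realType} {G T : Type} (d : T -> T -> R)
  (rho : G -> T -> T) : Prop :=
  forall K, mcompact d K -> finite_subset [set g | exists x, K x /\ K (rho g x)].

Definition convex {R : realType} {T : Type} (d : T -> T -> R) (C : set T) : Prop :=
  forall x y c, C x -> C y -> geodesic d c x y ->
    forall t, 0 <= t <= d x y -> C (c t).

Definition invariant {G T : Type} (rho : G -> T -> T) (C : set T) : Prop :=
  forall g x, C x -> C (rho g x).

(* C / Gamma compact (quotient topology): every cover of C by G-invariant sets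
   that are open relative to C has a finite subcover *)
Definition quotient_compact {R : realType} {G T : Type} (d : T -> T -> R)
  (rho : G -> T -> T) (C : set T) : Prop :=
  forall (I : Type) (U : I -> set T),
    (forall i, exists V, mopen d V /\ U i = V `&` C) ->
    (forall i, invariant rho (U i)) ->
    (forall x, C x -> exists i, U i x) ->
    exists n (f : 'I_n -> I), forall x, C x -> exists k, U (f k) x.

Definition convex_cocompact {R : realType} {G T : Type} (d : T -> T -> R)
  (rho : G -> T -> T) : Prop :=
  properly_discontinuous d rho /\
  exists C : set T, [/\ C !=set0, mclosed d C, invariant rho C, convex d C &
                         quotient_compact d rho C].

Definition transl_length {R : realType} {T : Type} (d : T -> T -> R) (g : T -> T) : R :=
  inf [set d x (g x) | x in [set: T]].

Definition hyperbolic {R : realType} {T : Type} (d : T -> T -> R) (g : T -> T) : Prop :=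
  (exists x0, forall x, d x0 (g x0) <= d x (g x)) /\ (forall x, g x <> x).

Definition geodesic_line {R : realType} {T : Type} (d : T -> T -> R) (c : R -> T) : Prop :=
  forall s t, d (c s) (c t) = `|s - t|.

Definition axis {R : realType} {T : Type} (d : T -> T -> R) (g : T -> T) (c : R -> T) : Prop :=
  [/\ geodesic_line d c, g @` range c = range c &
      forall t, d (c t) (g (c t)) = transl_length d g].

Definition nearest_point {R : realType} {T : Type} (d : T -> T -> R) (L : set T)
  (x p : T) : Prop := L p /\ forall q, L q -> d x p <= d x q.

Definition contracting {R : realType} {T : Type} (d : T -> T -> R) (L : set T) : Prop :=
  exists K : R, 0 < K /\
    forall x r, mball d x r `&` L = set0 ->
      forall y z p q, mball d x r y -> mball d x r z ->
        nearest_point d L y p -> nearest_point d L z q -> d p q <= K.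

Definition rank_one {R : realType} {T : Type} (d : T -> T -> R) (g : T -> T) : Prop :=
  hyperbolic d g /\ exists c, axis d g c /\ contracting d (range c).

(* Main.v *)
Require Import Defs.
From mathcomp Require Import all_boot all_order all_algebra.
From mathcomp Require Import boolp classical_sets reals.
From mathcomp Require Import topology normedtype derive.
From mathcomp Require Import ring lra.
Import Order.TTheory GRing.Theory Num.Theory.
Import numFieldNormedType.Exports.
Local Open Scope classical_set_scope.
Local Open Scope ring_scope.

(* Let p be a point of the invariant convex set C, with rho(Gamma) cobounded on C, and fix
   an axis of alpha in each factor. For every g and every N, one of the translates
   q = alpha^N p, alpha^-N p is such that, in X2, the base point of the axis of alpha
   separates q2 from the projection of g p2 to this axis; by contraction the geodesic from
   q2 to g p2 then passes near p2. The product geodesic from q to g p stays in C, hence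
   near the orbit of p. At the moment when its X2-coordinate is near p2, the nearby orbit
   point is h p with h in a finite set (proper discontinuity on X2), so its X1-coordinate
   is near p1 as well. Both coordinates have thus travelled the same fraction u of their
   length after N l1(alpha) and N l2(alpha) respectively, up to an error independent of g
   and N, so that
     N |d1(p1, g p1) l2(alpha) - d2(p2, g p2) l1(alpha)| <= M (d1(p1, g p1) + d2(p2, g p2)) + P_N.
   Applying this to g^(2^k), with d(x, g^(2^k) x) / 2^k -> l(g), and letting k, then N, tend
   to infinity gives l1(g) l2(alpha) = l2(g) l1(alpha). *)

(** * Comparison triangles and convexity of the distance *)

Section MetricGeometry.
Context {R : realType} {T : Type} (d : T -> T -> R).

(** The points (0,0), (a,0), (p,q) span a Euclidean triangle with sides a, b, c; p comes from the
    law of cosines, and the triangle inequalities give |p| <= c. *)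
Lemma comparison_triangle (a b c : R) : 0 <= a -> 0 <= c -> `|a - c| <= b -> b <= a + c ->
  exists p q : R, p ^+ 2 + q ^+ 2 = c ^+ 2 /\ (p - a) ^+ 2 + q ^+ 2 = b ^+ 2.
Proof.
move=> a0 c0; rewrite ler_norml => /andP[h1 h2] h3.
have b0 : 0 <= b by lra.
have [aE|an0] := eqVneq a 0.
  by exists c, 0; rewrite aE (_ : b = c); [split; ring|lra].
have a1 : 0 < a by rewrite lt_neqAle eq_sym an0.
pose p := (a ^+ 2 + c ^+ 2 - b ^+ 2) / (2 * a).
have pE : 2 * a * p = a ^+ 2 + c ^+ 2 - b ^+ 2 by rewrite /p; field; rewrite an0.
clearbody p.
have pc : 0 <= c ^+ 2 - p ^+ 2.
  have u1 : 0 <= c - p by rewrite -(pmulr_rge0 _ a1); nra.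
  have u2 : 0 <= c + p by rewrite -(pmulr_rge0 _ a1); nra.
  by have := mulr_ge0 u1 u2; lra.
exists p, (Num.sqrt (c ^+ 2 - p ^+ 2)); rewrite sqr_sqrtr //; split; [ring|].
have : (p - a) ^+ 2 = p ^+ 2 - 2 * a * p + a ^+ 2 by ring.
lra.
Qed.

Lemma eucl_sqr (p q : R * R) : eucl p q ^+ 2 = (p.1 - q.1) ^+ 2 + (p.2 - q.2) ^+ 2.
Proof. by rewrite /eucl sqr_sqrtr // addr_ge0 ?sqr_ge0. Qed.

Lemma eucl_eq (p q : R * R) (r : R) : 0 <= r ->
  (p.1 - q.1) ^+ 2 + (p.2 - q.2) ^+ 2 = r ^+ 2 -> eucl p q = r.
Proof. by move=> r0; rewrite /eucl => ->; rewrite sqrtr_sqr ger0_norm. Qed.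

Context (HC : CAT0 d).

Lemma dist_ge0 x y : 0 <= d x y. Proof. by case: HC => -[]. Qed.
Lemma dist_sym x y : d x y = d y x. Proof. by case: HC => -[]. Qed.
Lemma dist_tri x y z : d x z <= d x y + d y z. Proof. by case: HC => -[]. Qed.
Lemma dist_eq0 x y : d x y = 0 <-> x = y. Proof. by case: HC => -[]. Qed.
Lemma distxx x : d x x = 0. Proof. exact/dist_eq0. Qed.
Lemma dist_geod x y : exists c, geodesic d c x y. Proof. by case: HC => _ + _; exact. Qed.
Hint Resolve dist_ge0 : core.

Lemma dist_lip x y z : `|d x y - d x z| <= d y z.
Proof.
have := dist_tri x y z; have := dist_tri x z y; rewrite (dist_sym z y).
by move=> *; rewrite ler_norml; apply/andP; split; lra.
Qed.

Lemma frac_bound (u D : R) : 0 <= u <= 1 -> 0 <= D -> 0 <= u * D <= D.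
Proof. by move=> /andP[u0 u1] D0; rewrite mulr_ge0 //= ler_piMl. Qed.

(* Stewart's identity in the comparison triangle. *)
Lemma stewart z x y c (u : R) : geodesic d c x y -> 0 <= u <= 1 ->
  d z (c (u * d x y)) ^+ 2 <=
    (1 - u) * d z x ^+ 2 + u * d z y ^+ 2 - u * (1 - u) * d x y ^+ 2.
Proof.
move=> gc u01.
have [cyz gyz] := dist_geod y z; have [czx gzx] := dist_geod z x.
have [||||p [q [E1 E2]]] := @comparison_triangle (d x y) (d y z) (d z x) => //.
- by rewrite (dist_sym z x) dist_lip.
- by rewrite (dist_sym x y) (dist_sym z x) dist_tri.
have [_ _ /(_ x y z c cyz czx (0, 0) (d x y, 0) (p, q) gc gyz gzx)] := HC.
have e1 : eucl (0, 0) (d x y, 0) = d x y by apply: eucl_eq => //=; ring.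
have e2 : eucl (d x y, 0) (p, q) = d y z by apply: eucl_eq => //=; rewrite -E2; ring.
have e3 : eucl (p, q) (0, 0) = d z x by apply: eucl_eq => //=; rewrite -E1; ring.
move=> /(_ e1 e2 e3) /= /(_ (z, (p, q)) (c (u * d x y), seg_pt (0,0) (d x y, 0) (u * d x y))).
move=> /= key.
have H : d z (c (u * d x y)) <= eucl (p, q) (seg_pt (0, 0) (d x y, 0) (u * d x y)).
  apply: key.
- right; exists 0; rewrite lexx dist_ge0; split => //.
  by rewrite (_ : czx 0 = z); [rewrite /seg_pt /= !mul0r !addr0|case: gzx].
- by left; left; exists (u * d x y); split => //; exact: frac_bound.
apply: le_trans (_ : eucl (p, q) (seg_pt (0, 0) (d x y, 0) (u * d x y)) ^+ 2 <= _).
  by rewrite lerXn2r // ?nnegrE // sqrtr_ge0.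
rewrite eucl_sqr /seg_pt /= e1.
have -> : u * d x y / d x y * (d x y - 0) = u * d x y.
  have [->|n0] := eqVneq (d x y) 0; first by rewrite !mulr0 !mul0r.
  by field.
rewrite (dist_sym z y) -E1 -E2 le_eqVlt; apply/orP; left; apply/eqP; ring.
Qed.

(** Stewart's inequality is applied to [c1 (s * d o x)] against [c2], then to [y] against [c1]; the
    terms in [d o x] and [d o y] cancel. *)
Lemma thin o x y c1 c2 (s : R) : geodesic d c1 o x -> geodesic d c2 o y -> 0 <= s <= 1 ->
  d (c1 (s * d o x)) (c2 (s * d o y)) <= s * d x y.
Proof.
move=> g1 g2 s01.
have h1 := @stewart (c1 (s * d o x)) _ _ _ s g2 s01.
have h2 := @stewart y _ _ _ s g1 s01.
have h3 : d (c1 (s * d o x)) o = s * d o x.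
  case: g1 => g0 g1 gE; rewrite -{2}g0 gE ?lexx ?dist_ge0 ?frac_bound //.
  by rewrite subr0 ger0_norm // mulr_ge0 //; case/andP: s01.
case/andP: s01 => s0 s1.
rewrite -(@ler_sqr _ _ _) ?nnegrE ?mulr_ge0 //.
rewrite h3 (dist_sym (c1 _) y) in h1; rewrite (dist_sym y o) (dist_sym y x) in h2.
have h4 := ler_wpM2l s0 h2.
lra.
Qed.

Lemma geodesic_rev c x y : geodesic d c x y -> geodesic d (fun t => c (d x y - t)) y x.
Proof.
case=> c0 c1 cE; split; rewrite ?subr0 //; first by rewrite (dist_sym y x) subrr.
move=> s t; rewrite (dist_sym y x) => /andP[? ?] /andP[? ?].
by rewrite cE; [rewrite distrC; congr `|_|; ring|apply/andP; split; lra..].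
Qed.

(** Reversing both geodesics turns the common end into the common origin of [thin]; the factor 1 - u
    is then bounded by 1. *)
Lemma thin_end x x' y c c' (u : R) : geodesic d c x y -> geodesic d c' x' y -> 0 <= u <= 1 ->
  d (c (u * d x y)) (c' (u * d x' y)) <= d x x'.
Proof.
move=> g g' /andP[u0 u1].
have u01 : 0 <= 1 - u <= 1 by apply/andP; split; lra.
have := thin _ _ _ _ _ _ (geodesic_rev _ _ _ g) (geodesic_rev _ _ _ g') u01.
rewrite !(dist_sym y).
have e D : D - (1 - u) * D = u * D by ring.
rewrite !e => h; apply: le_trans h _.
by rewrite ler_piMl //; lra.
Qed.

Lemma geodesic_prefix c x y (t : R) : geodesic d c x y -> 0 <= t <= d x y ->
  d x (c t) = t /\ geodesic d c x (c t).
Proof.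
move=> [c0 c1 cE] t01; have xt : d x (c t) = t.
  rewrite -c0 cE ?lexx ?dist_ge0 //= sub0r normrN ger0_norm //.
  by case/andP: t01.
split => //; split; rewrite ?xt // => r s /andP[? ?] /andP[? ?].
by apply: cE; apply/andP; split; lra.
Qed.

Lemma geodesic_dist_end c x y (t : R) : geodesic d c x y -> 0 <= t <= d x y ->
  d y (c t) = d x y - t.
Proof.
move=> [c0 c1 cE] t01; rewrite -{1}c1 cE ?lexx ?dist_ge0 //.
by rewrite ger0_norm // subr_ge0; case/andP: t01.
Qed.

(** The sign of [t - s] directs the path along the line; for [s = t] it is constant, of length 0. *)
Lemma line_geodesic c (s t : R) : geodesic_line d c ->
  geodesic d (fun r => c (s + Num.sg (t - s) * r)) (c s) (c t).
Proof.
move=> cl; split; first by rewrite mulr0 addr0.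
  by rewrite cl distrC -numEsg addrC subrK.
move=> r r'; rewrite !cl => /andP[r0 r1] /andP[r0' r1'].
have -> : s + Num.sg (t - s) * r - (s + Num.sg (t - s) * r') = Num.sg (t - s) * (r - r') by ring.
have [ts|ts] := eqVneq t s; last by rewrite normrM normr_sg subr_eq0 ts mul1r.
rewrite ts subrr normr0 in r1 r1' *; have -> : r = r' by lra.
by rewrite subrr mulr0.
Qed.

End MetricGeometry.

(** * Nearest-point projection to a contracting line *)

Section Contraction.
Context {R : realType} {T : Type} (d : T -> T -> R) (HC : CAT0 d) (c : R -> T).
Context (cl : geodesic_line d c).

Let dg0 x y : 0 <= d x y := dist_ge0 d HC x y.
Hint Resolve dg0 : core.

(** Outside [[- r, r]] the points of the line are farther from [y] than [c 0], so the extreme value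
    theorem on this interval suffices. *)
Lemma nearest_point_line y : exists s, nearest_point d (range c) y (c s).
Proof.
pose f s := d y (c s); pose r := 2 * d y (c 0).
have fc : continuous (f : R -> R).
  move=> s; apply/cvgrPdist_lt => e e0; near=> t.
  apply: le_lt_trans (dist_lip d HC _ _ _) _; rewrite cl.
  by near: t; exact: cvgr_dist_lt.
have r0 : - r <= r by have := dg0 y (c 0); rewrite /r; lra.
have [m _ mmin] := EVT_min r0 (continuous_subspaceT fc).
exists m; split; first by exists m.
move=> _ [s _ <-]; have [sr|sr] := boolP (s \in `[- r, r]%R); first exact: mmin.
apply: (@le_trans _ _ (d y (c 0))).
  by apply: mmin; rewrite in_itv /=; apply/andP; split; have := dg0 y (c 0); rewrite /r; lra.
move: sr; rewrite in_itv /= -ler_norml -ltNge => sr.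
have := dist_tri d HC (c s) y (c 0); rewrite cl subr0 (dist_sym d HC (c s) y).
by move: sr; rewrite /r; lra.
Unshelve. all: by end_near.
Qed.

(** The angle at [w'] is at least a right angle: if [q] were nearer to [w] than to [w'], some point
    of the line between [w'] and [q] would be nearer to [w] than [w'] is. *)
Lemma projection_le w w' q : nearest_point d (range c) w w' -> range c q -> d w' q <= d w q.
Proof.
move=> [[s _ <-] wmin] [t _ <-]; rewrite leNgt; apply/negP => lt_ab.
have gam := line_geodesic d c s t cl.
set a := d w (c t) in lt_ab *; set b := d (c s) (c t) in lt_ab *.
have a0 : 0 <= a := dg0 _ _.
have b0 : 0 < b by lra.
have ab : a ^+ 2 < b ^+ 2 by rewrite ltr_sqr ?nnegrE // ltW.
have b20 : 0 < b ^+ 2 by rewrite exprn_gt0.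
(* For this u, minimality at [c s] and Stewart's inequality give u (D^2 + (b^2 - a^2)/2) <= 0 with D
   = [d w (c s)], against a < b. *)
pose u := (b ^+ 2 - a ^+ 2) / (2 * b ^+ 2).
have uE : u * b ^+ 2 = (b ^+ 2 - a ^+ 2) / 2 by rewrite /u; field; rewrite gt_eqF.
clearbody u.
have u0 : 0 < u by rewrite -(pmulr_lgt0 _ b20); lra.
have u1 : u <= 1 by rewrite -(ler_pM2r b20); have := sqr_ge0 a; lra.
have u01 : 0 <= u <= 1 by rewrite (ltW u0).
have := stewart d HC w _ _ _ u gam u01; rewrite -/a -/b.
set z := c _ => zle.
have : d w (c s) ^+ 2 <= d w z ^+ 2.
  by rewrite ler_sqr ?nnegrE //; apply: wmin; exists (s + Num.sg (t - s) * (u * b)).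
move=> /le_trans/(_ zle); move: (sqr_ge0 (d w (c s))) => D0 H.
have : u * (d w (c s) ^+ 2 + (b ^+ 2 - a ^+ 2) / 2) <= 0 by nra.
by rewrite pmulr_rle0 //; lra.
Qed.

Context (K : R) (K0 : 0 < K).
Context (contr : forall x r, mball d x r `&` range c = set0 ->
      forall y z p q, mball d x r y -> mball d x r z ->
        nearest_point d (range c) y p -> nearest_point d (range c) z q -> d p q <= K).

(** The open ball about [y] of radius [d y z] misses the line and contains [y']: the 1 gives strict
    inequality, and the maximum with 0 forces [y' = y] when [d y z] is at most 1. If [y] is on the
    line this ball is empty, but then [z' = z]. *)
Lemma contracting_move y z y' z' : nearest_point d (range c) y z ->
  nearest_point d (range c) y' z' -> d y y' <= Num.max (d y z - 1) 0 -> d z z' <= K.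
Proof.
move=> yz yz' dy; have [yz0|yz0] := eqVneq (d y z) 0.
  have yE : y = z by apply/(dist_eq0 d HC).
  have mx : Num.max (0 - 1) 0 = 0 :> R by apply: max_r; lra.
  move: dy; rewrite yz0 mx.
  move=> dy; have y'E : y = y' by apply/(dist_eq0 d HC)/le_anti/andP.
  have [_ /(_ z (proj1 yz))] := yz'; rewrite -y'E {1}yE yz0 => h.
  exact: le_trans h (ltW K0).
have yz1 : 0 < d y z by rewrite lt_neqAle eq_sym yz0 dg0.
apply: (contr y (d y z) _ y y') => //.
- rewrite -subset0 => q [yq Lq]; have := proj2 yz q Lq.
  by rewrite leNgt (yq : d y q < d y z).
- by rewrite /mball /= distxx.
- by apply: le_lt_trans dy _; rewrite gt_max yz1 andbT; lra.
Qed.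

(** From [y] the geodesic is followed towards [q = c s] in two jumps, to [w] and then to [v], each
    about 1 shorter than the distance to the line, so each moves the projection by at most K. As
    [v'] is no farther from [q] than [v], the jumps total at most [d y z] + 2K. The second is thus
    at most 2K + 1, which puts [w] within 2K + 2 of [w'] and 3K + 2 of [z]. *)
Lemma geodesic_near_projection s y s0 sigma :
  nearest_point d (range c) y (c s0) -> geodesic d sigma (c s) y ->
  exists t, 0 <= t <= d (c s) y /\ d (sigma t) (c s0) <= 3 * K + 2.
Proof.
move=> yz gs; set q := c s in gs *; set z := c s0 in yz *.
have Lq : range c q by exists s.
have Lz : range c z by exists s0.
have dsym := dist_sym d HC; have dtri := dist_tri d HC.
pose r1 := Num.max (d y z - 1) 0.
have hT : d y z <= d q y by rewrite (dsym q); exact: (proj2 yz).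
have r1E : [/\ 0 <= r1, r1 <= d y z & d y z - 1 <= r1].
  by rewrite /r1; case: (leP (d y z - 1) 0) => ?; split; rewrite ?dg0; lra.
case: r1E => r10 r1h r1h'.
have t1 : 0 <= d q y - r1 <= d q y by apply/andP; split; lra.
pose w := sigma (d q y - r1).
have [qw gw] := geodesic_prefix d HC _ _ _ _ gs t1; rewrite -/w in qw gw.
have yw : d y w = r1 by rewrite /w (geodesic_dist_end d HC _ _ _ _ gs t1); ring.
have [s1] := nearest_point_line w; set w' := c s1 => ww'.
have zw' : d z w' <= K by apply: contracting_move yz ww' _; rewrite yw.
pose r2 := Num.max (d w w' - 1) 0.
have gT : d w w' <= d q w by rewrite (dsym q); exact: (proj2 ww').
have r2E : [/\ 0 <= r2, r2 <= d w w' & d w w' - 1 <= r2].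
  by rewrite /r2; case: (leP (d w w' - 1) 0) => ?; split; rewrite ?dg0; lra.
case: r2E => r20 r2h r2h'.
have t2 : 0 <= d q w - r2 <= d q w by apply/andP; split; lra.
pose v := sigma (d q w - r2).
have [qv _] := geodesic_prefix d HC _ _ _ _ gw t2; rewrite -/v in qv.
have wv : d w v = r2 by rewrite /v (geodesic_dist_end d HC _ _ _ _ gw t2); ring.
have [s2] := nearest_point_line v; set v' := c s2 => vv'.
have wv' : d w' v' <= K by apply: contracting_move ww' vv' _; rewrite wv.
exists (d q y - r1); split => //; rewrite -/w.
have := projection_le _ _ _ vv' Lq.
have := dtri z w' v'; have := dtri z v' q; have := dtri y z q.
have := dtri w w' z.
rewrite (dsym y q) (dsym w' z) (dsym v q); lra.
Qed.

(** The sign condition places [c 0] between [c s] and [c s0]. The segment of the line from [c s] to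
    [c s0] and the part of [sigma] up to its point near [c s0] start together, so [thin] carries the
    closeness back to [c 0]. *)
Lemma geodesic_near_between s y s0 sigma : s * s0 <= 0 ->
  nearest_point d (range c) y (c s0) -> geodesic d sigma (c s) y ->
  exists u, 0 <= u <= 1 /\ d (c 0) (sigma (u * d (c s) y)) <= 3 * K + 2.
Proof.
move=> ss0 yz gs; have [t [t01 tB]] := geodesic_near_projection _ _ _ _ yz gs.
have [qt gt] := geodesic_prefix d HC _ _ _ _ gs t01.
have gl := line_geodesic d c s s0 cl.
have frac (a b : R) : 0 <= a <= b -> exists u, 0 <= u <= 1 /\ a = u * b.
  move=> /andP[a0 ab]; have [b0|b0] := eqVneq b 0.
    by exists 0; rewrite lexx ler01; split=> //; rewrite b0 in ab *; lra.
  have b1 : 0 < b by rewrite lt_neqAle eq_sym b0 (le_trans a0).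
  by exists (a / b); rewrite divfK // divr_ge0 ?ler_pdivrMr ?mul1r // ltW.
have sd : 0 <= `|s| <= d (c s) (c s0).
  rewrite normr_ge0 cl /=.
  rewrite -ler_sqr ?nnegrE // !real_normK ?num_real //.
  by have := sqr_ge0 s0; nra.
have [v [v01 vE]] := frac _ _ sd.
have := thin d HC _ _ _ _ _ _ gt gl v01; rewrite -vE.
have -> : s + Num.sg (s0 - s) * `|s| = 0.
  have [->|sn0] := eqVneq s 0; first by rewrite normr0 mulr0 addr0.
  have [sp|sp] := ltP 0 s.
    by rewrite ltr0_sg ?gtr0_norm //; [ring|nra].
  have {}sp : s < 0 by rewrite lt_neqAle sn0.
  by rewrite gtr0_sg ?ltr0_norm //; [ring|nra].
rewrite qt (dist_sym d HC _ (c 0)) => vB.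
have [u [u01 uE]] : exists u, 0 <= u <= 1 /\ v * t = u * d (c s) y.
  apply: frac; case/andP: t01 => ? ?; case/andP: v01 => ? ?.
  by rewrite mulr_ge0 //= (le_trans _ (_ : t <= _)) // ler_piMl.
exists u; split => //; rewrite -uE; apply: le_trans vB _.
apply: le_trans tB; rewrite ler_piMl //; by case/andP: v01.
Qed.

End Contraction.

(** * Translation length and displacement of iterates *)

Section TranslationLength.
Context {R : realType} {T : Type} (d : T -> T -> R) (HC : CAT0 d) (f : T -> T).

Lemma transl_length_le x : transl_length d f <= d x (f x).
Proof.
apply: ge_inf; last by exists x.
by exists 0 => _ [y _ <-]; exact: dist_ge0.
Qed.

Lemma transl_length_approx (x0 : T) (e : R) : 0 < e ->
  exists x, d x (f x) < transl_length d f + e.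
Proof.
move=> e0; have hA : has_inf [set d x (f x) | x in [set: T]].
  split; first by exists (d x0 (f x0)), x0.
  by exists 0 => _ [y _ <-]; exact: dist_ge0.
by have [_ [x _ <-] lt] := inf_adherent e0 hA; exists x.
Qed.

Lemma hyperbolic_transl_length_gt0 : hyperbolic d f -> 0 < transl_length d f.
Proof.
case=> -[x0 x0min] nofix; apply: (@lt_le_trans _ _ (d x0 (f x0))).
  rewrite lt_neqAle dist_ge0 // andbT eq_sym; apply/eqP => /(dist_eq0 d HC) e.
  by apply: (nofix x0).
by apply: lb_le_inf => [|_ [y _ <-]//]; exists (d x0 (f x0)), x0.
Qed.

Context (fiso : Defs.isometry d f).

Lemma dist_translates_le x y : `|d (f x) x - d (f y) y| <= 2 * d x y.
Proof.
have := dist_tri d HC (f x) (f y) x; have := dist_tri d HC (f y) y x.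
have := dist_tri d HC (f y) (f x) y; have := dist_tri d HC (f x) x y.
rewrite !fiso (dist_sym d HC y x) => *; rewrite ler_norml; apply/andP; split; lra.
Qed.

Lemma isometry_iter n : Defs.isometry d (iter n f).
Proof. by elim: n => // n IH x y /=; rewrite fiso. Qed.

(* The midpoint m of x, f^n x satisfies 2 d(m, f^n m) <= d(x, f^(2n) x). *)
Lemma displacement_pow2_ge k x :
  2 ^+ k * transl_length d f <= d x (iter (2 ^ k) f x).
Proof.
elim: k x => [|k IH] x; first by rewrite expr0 mul1r; exact: transl_length_le.
set F := iter (2 ^ k) f in IH.
have Fi : Defs.isometry d F := isometry_iter _.
have -> : iter (2 ^ k.+1) f x = F (F x) by rewrite expnS mul2n -addnn iterD.
have [c gc] := dist_geod d HC x (F x).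
have gFc : geodesic d (F \o c) (F x) (F (F x)).
  by case: gc => c0 c1 cE; split; rewrite /= ?c0 // ?Fi ?c1 // => s t hs ht; rewrite Fi cE.
have h2 : 0 <= (1 / 2 : R) <= 1 by apply/andP; split; lra.
(* Both geodesics start at [F x], one back to [x], the other the image of [c]; at fraction 1/2 they
   are at m and F m. *)
have := thin d HC _ _ _ _ _ _ (geodesic_rev d HC _ _ _ gc) gFc h2.
rewrite /= Fi (dist_sym d HC (F x) x).
have -> : d x (F x) - 1 / 2 * d x (F x) = 1 / 2 * d x (F x) by field.
by have := IH (c (1 / 2 * d x (F x))); rewrite exprS; lra.
Qed.

Lemma displacement_iter_le n x : d x (iter n f x) <= n%:R * d x (f x).
Proof.
elim: n => [|n IH] /=; first by rewrite distxx // mul0r.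
have := dist_tri d HC x (iter n f x) (f (iter n f x)).
have : d (iter n f x) (f (iter n f x)) = d x (f x).
  by rewrite -iterS iterSr isometry_iter.
by rewrite -natr1 mulrDl mul1r; lra.
Qed.

End TranslationLength.

(** * Growth rates along powers of two *)

Section GrowthRate.
Context {R : realType}.
Implicit Types (a b : nat -> R) (x y L : R).

(** A quantitative form of a_k / 2^k tending to L, matching what displacements satisfy: an exact
    lower bound, and an upper bound with arbitrarily small slope error. *)
Definition growth_rate a L := forall e, 0 < e ->
  exists P, forall k, 2 ^+ k * L <= a k <= 2 ^+ k * (L + e) + P.

Lemma le_of_nat_mul x y : (forall n : nat, n.+1%:R * x <= y) -> x <= 0.
Proof.
move=> h; rewrite leNgt; apply/negP => x0.
have := h (Num.truncn (y / x)); apply/negP; rewrite -ltNge.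
by rewrite -ltr_pdivrMr //; exact: truncnS_gt.
Qed.

Lemma le_of_pow2 x y P : (forall k, 2 ^+ k * x <= 2 ^+ k * y + P) -> x <= y.
Proof.
move=> h; rewrite -subr_le0 leNgt; apply/negP => s0.
suff : x - y <= 0 by rewrite leNgt s0.
apply: (le_of_nat_mul _ P) => n; have : n.+1%:R <= 2 ^+ n :> R.
  by rewrite -natrX ler_nat ltn_expl.
by move=> /(ler_wpM2r (ltW s0)); have := h n; lra.
Qed.

(** Dividing by 2^k and letting k grow removes P, which may depend on n; dividing by n and letting n
    grow then removes the M term. *)
Lemma growth_rate_cross_le a b La Lb (la lb M : R) :
  0 <= la -> 0 <= lb -> 0 <= M -> growth_rate a La -> growth_rate b Lb ->
  (forall n : nat, exists P, forall k, n%:R * (a k * lb - b k * la) <= M * (a k + b k) + P) ->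
  La * lb <= Lb * la.
Proof.
move=> la0 lb0 M0 ga gb H; rewrite -subr_le0.
apply: (le_of_nat_mul _ (la + M * (La + Lb + 2))) => n.
have n0 : 0 < n.+1%:R :> R by rewrite ltr0n.
have n1 : 1 <= n.+1%:R :> R by rewrite ler1n.
(* The slope error is 1/N, so that after multiplication by N it contributes only [la]. *)
have en : 0 < n.+1%:R^-1 :> R by rewrite invr_gt0.
have e1 : n.+1%:R^-1 <= 1 :> R by rewrite invf_le1.
have eE : n.+1%:R * n.+1%:R^-1 = 1 :> R by rewrite divff // gt_eqF.
have [Pa aP] := ga _ en; have [Pb bP] := gb _ en; have [P Pk] := H n.+1.
move: (n.+1%:R) (n.+1%:R^-1) n0 n1 en e1 eE aP bP Pk => N e N0 N1 e0 e1 Ne aP bP Pk.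
apply: (le_of_pow2 _ _ (N * Pb * la + M * (Pa + Pb) + P)) => k.
have /andP[a1 a2] := aP k; have /andP[b1 b2] := bP k; have := Pk k.
have t0 : 0 < 2 ^+ k :> R by rewrite exprn_gt0.
move: (2 ^+ k) t0 a1 a2 b1 b2 => t t0 a1 a2 b1 b2 h.
have h1 : N * (t * La) * lb <= N * a k * lb by rewrite ler_wpM2r // ler_wpM2l // ltW.
have h2 : N * b k * la <= N * (t * (Lb + e) + Pb) * la by rewrite ler_wpM2r // ler_wpM2l // ltW.
have h3 : M * (a k + b k) <= M * (t * (La + e) + Pa + (t * (Lb + e) + Pb)).
  by rewrite ler_wpM2l // lerD.
have h4 : M * (t * (2 * e)) <= M * (t * 2).
  by apply: ler_wpM2l => //; apply: ler_wpM2l; lra.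
have h5 : N * (t * e) * la = t * la by rewrite -[RHS]mul1r -Ne; ring.
lra.
Qed.

End GrowthRate.

(** * Action of an isometry on its axis *)

Section Axis.
Context {R : realType} {T : Type} (d : T -> T -> R) (HC : CAT0 d).

(** If f (c s) = c s', constant displacement gives |s - s'| = |tau| and the distance to f (c 0)
    gives |tau - s'| = |s|; for s other than tau this leaves only s' = s + tau. *)
Lemma axis_translation f c : Defs.isometry d f -> axis d f c -> 0 < transl_length d f ->
  exists tau, `|tau| = transl_length d f /\ forall s, f (c s) = c (s + tau).
Proof.
move=> fi [cl fr fl] l0; have [tau tauE] : exists t, f (c 0) = c t.
  have : range c (f (c 0)) by rewrite -fr; exists (c 0) => //; exists 0.
  by case=> t _ <-; exists t.
have tl : `|tau| = transl_length d f by rewrite -(fl 0) tauE cl sub0r normrN.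
have tn0 : tau != 0 by rewrite -normr_gt0 tl.
exists tau; split => //.
have key s : exists2 s', f (c s) = c s' & `|s - s'| = `|tau| /\ `|tau - s'| = `|s|.
  have : range c (f (c s)) by rewrite -fr; exists (c s) => //; exists s.
  case=> s' _ s'E; exists s' => //; split; first by rewrite -cl s'E tl.
  by rewrite -cl -tauE s'E fi cl sub0r normrN.
have gen s : s != tau -> f (c s) = c (s + tau).
  move=> st; have [s' -> [/eqP h1 /eqP h2]] := key s; congr c.
  move: h1 h2; rewrite !eqr_norm2 => /orP[]/eqP h1; last by lra.
  case/orP=> /eqP h2; first by move/eqP: tn0; case; lra.
  by move/eqP: st; case; lra.
(* At s = tau the value s' = 0 also remains; the distance to f (c (2 tau)) = c (3 tau) excludes
   it. *)
move=> s; have [->|] := eqVneq s tau; last exact: gen.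
have [s' s'E [h1 /eqP h2]] := key tau; rewrite s'E; congr c.
have t2 : 2 * tau != tau by apply/eqP => ?; move/eqP: tn0; case; lra.
have : d (f (c tau)) (f (c (2 * tau))) = `|tau|.
  by rewrite fi cl -normrN; congr `|_|; ring.
rewrite s'E gen // cl => /eqP h3.
move: h2 h3; rewrite !eqr_norm2 => /orP[]/eqP h2 /orP[]/eqP h3;
  move/eqP: tn0 => tn0; first [lra | by case: tn0; lra].
Qed.
End Axis.

(** * Displacements and axes under a single action *)

Section Actions.
Context {R : realType} {G : Type} (mul : G -> G -> G) (inv : G -> G) (one : G).
Context (HG : is_group mul inv one).

Definition gpow (g : G) n := iter n (mul g) one.

Section OneAction.
Context {T : Type} (d : T -> T -> R) (HC : CAT0 d) (rho : G -> T -> T).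
Context (act : isometric_action mul one d rho).

Lemma action_iso g : Defs.isometry d (rho g). Proof. by case: act. Qed.

Lemma action_inv g x : rho (inv g) (rho g x) = x.
Proof. by case: act => aM a1 _; rewrite -aM; have [_ _ /(_ g) [-> _]] := HG. Qed.

Lemma action_gpow g n x : rho (gpow g n) x = iter n (rho g) x.
Proof. by case: act => aM a1 _; elim: n => //= n IH; rewrite aM IH. Qed.

(** The upper bound passes to a point [y] of almost minimal displacement, at the additive cost
    [2 * d x y]. *)
Lemma growth_rate_displacement g x :
  growth_rate (fun k => d x (rho (gpow g (2 ^ k)) x)) (transl_length d (rho g)).
Proof.
have iso := action_iso.
move=> e e0; have [y ylt] := transl_length_approx d HC (rho g) x e e0.
exists (2 * d x y) => k; rewrite !action_gpow displacement_pow2_ge //=.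
have := displacement_iter_le d HC _ (iso g) (2 ^ k) y.
set F := iter (2 ^ k) (rho g); rewrite natrX => h.
have Fi : Defs.isometry d F := isometry_iter d _ (iso g) _.
have := dist_tri d HC x y (F x); have := dist_tri d HC y (F y) (F x).
rewrite Fi (dist_sym d HC y x) => h1 h2.
have : 2 ^+ k * d y (rho g y) <= 2 ^+ k * (transl_length d (rho g) + e).
  by rewrite ler_wpM2l ?exprn_ge0 // ltW.
lra.
Qed.

(** The shift [tau] is signed, since the parametrization of the axis need not follow the direction
    of [alpha]. *)
Lemma rank_one_axis alpha : rank_one d (rho alpha) ->
  exists c tau, [/\ geodesic_line d c, contracting d (range c),
    0 < transl_length d (rho alpha), `|tau| = transl_length d (rho alpha) &
    forall n, rho (gpow alpha n) (c 0) = c (n%:R * tau) /\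
              rho (gpow (inv alpha) n) (c 0) = c (- (n%:R * tau))].
Proof.
case=> hyp [c [ax con]]; have l0 := hyperbolic_transl_length_gt0 d HC _ hyp.
have [tau [tl tE]] := axis_translation d _ _ (action_iso alpha) ax l0.
exists c, tau; split=> //; first by case: ax.
move=> n; rewrite !action_gpow; elim: n => [|n [IH1 IH2]] /=.
  by rewrite mul0r oppr0.
rewrite IH1 IH2 tE -natr1 mulrDl mul1r; split => //.
by rewrite -[RHS](action_inv alpha) tE; congr (rho _ (c _)); ring.
Qed.

Lemma orbit_bound (P : set G) (x : T) : finite_subset P ->
  exists M, 0 <= M /\ forall g, P g -> d x (rho g x) <= M.
Proof.
case=> n [f Pf]; exists (\sum_(k < n) d x (rho (f k) x)); split.
  by apply: sumr_ge0 => k _; exact: dist_ge0.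
move=> g /Pf [k ->]; rewrite (bigD1 k) //= lerDl.
by apply: sumr_ge0 => j _; exact: dist_ge0.
Qed.

End OneAction.

(** * The diagonal action on the product *)

Section TwoActions.
Context {X1 X2 : Type} (d1 : X1 -> X1 -> R) (d2 : X2 -> X2 -> R).
Context (rho1 : G -> X1 -> X1) (rho2 : G -> X2 -> X2).
Context (HC1 : CAT0 d1) (HC2 : CAT0 d2).
Context (act1 : isometric_action mul one d1 rho1) (act2 : isometric_action mul one d2 rho2).
Let rho g (p : X1 * X2) := (rho1 g p.1, rho2 g p.2).

(** Closed balls of X2 are compact, so only finitely many group elements move [x2] by at most r;
    this transfers closeness from X2 to X1. *)
Lemma properly_discontinuous_bound (x1 : X1) (x2 : X2) r : proper_space d2 ->
  properly_discontinuous d2 rho2 ->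
  exists M, 0 <= M /\ forall g, d2 x2 (rho2 g x2) <= r -> d1 x1 (rho1 g x1) <= M.
Proof.
move=> prop pd; have [M [M0 HM]] := orbit_bound d1 HC1 rho1 _ x1 (pd _ (prop x2 (Num.max r 0))).
exists M; split => // g gr; apply: HM; exists x2.
by split; rewrite /mcball /= ?distxx // le_max ?lexx ?orbT // gr.
Qed.

Lemma prod_dist_ge1 p q : d1 p.1 q.1 <= prod_dist d1 d2 p q.
Proof.
rewrite -[X in X <= _]ger0_norm ?dist_ge0 // -sqrtr_sqr ler_wsqrtr //.
by rewrite lerDl sqr_ge0.
Qed.

Lemma prod_dist_ge2 p q : d2 p.2 q.2 <= prod_dist d1 d2 p q.
Proof.
rewrite -[X in X <= _]ger0_norm ?dist_ge0 // -sqrtr_sqr ler_wsqrtr //.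
by rewrite lerDr sqr_ge0.
Qed.

(** The sets of points within n of the orbit of [p] in both coordinates are open, invariant and
    increasing in n, and they cover C. *)
Lemma quotient_compact_cobounded (C : set (X1 * X2)) p : Defs.invariant rho C ->
  quotient_compact (prod_dist d1 d2) rho C -> exists D : R, forall x, C x ->
    exists g, d1 x.1 (rho1 g p.1) < D /\ d2 x.2 (rho2 g p.2) < D.
Proof.
move=> Cinv qc.
pose V (n : nat) := [set x : X1 * X2 |
  exists g, d1 x.1 (rho1 g p.1) < n%:R /\ d2 x.2 (rho2 g p.2) < n%:R].
have [| | |m [f Hf]] := qc nat (fun n => V n `&` C).
- move=> n; exists (V n); split => // x [g [h1 h2]].
  exists (Num.min (n%:R - d1 x.1 (rho1 g p.1)) (n%:R - d2 x.2 (rho2 g p.2))).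
  rewrite lt_min !subr_gt0 h1 h2; split => // y; rewrite /mball /= lt_min => /andP[y1 y2].
  exists g; have := prod_dist_ge1 x y; have := prod_dist_ge2 x y.
  have := dist_tri d1 HC1 y.1 x.1 (rho1 g p.1); have := dist_tri d2 HC2 y.2 x.2 (rho2 g p.2).
  rewrite (dist_sym d1 HC1 y.1 x.1) (dist_sym d2 HC2 y.2 x.2) => *; split; lra.
- move=> n g x [[h [h1 h2]] Cx]; split; last exact: Cinv.
  exists (mul g h) => /=; case: act1 => -> _ ->; case: act2 => -> _ ->; by split.
- move=> x Cx; pose t := d1 x.1 (rho1 one p.1) + d2 x.2 (rho2 one p.2).
  exists (Num.truncn t).+1; split => //; exists one.
  have := truncnS_gt t; have := dist_ge0 d1 HC1 x.1 (rho1 one p.1).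
  by have := dist_ge0 d2 HC2 x.2 (rho2 one p.2); rewrite /t => *; split; lra.
exists (\max_(k < m) f k)%:R => x /Hf [k [[g [h1 h2]] _]]; exists g.
have fk : (f k)%:R <= (\max_(k < m) f k)%:R :> R by rewrite ler_nat leq_bigmax.
by split; apply: lt_le_trans fk.
Qed.

(** Two geodesics run proportionally to their lengths a and b form a geodesic of the product,
    because D^2 = a^2 + b^2. *)
Lemma convex_prod_geodesic (C : set (X1 * X2)) x y c1 c2 u :
  convex (prod_dist d1 d2) C -> C x -> C y ->
  geodesic d1 c1 x.1 y.1 -> geodesic d2 c2 x.2 y.2 -> 0 <= u <= 1 ->
  C (c1 (u * d1 x.1 y.1), c2 (u * d2 x.2 y.2)).
Proof.
move=> Cc Cx Cy [c10 c11 c1E] [c20 c21 c2E] u01.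
set a := d1 x.1 y.1 in c11 c1E *; set b := d2 x.2 y.2 in c21 c2E *.
have a0 : 0 <= a := dist_ge0 d1 HC1 _ _; have b0 : 0 <= b := dist_ge0 d2 HC2 _ _.
set D := prod_dist d1 d2 x y; have D2 : D ^+ 2 = a ^+ 2 + b ^+ 2.
  by rewrite /D /prod_dist sqr_sqrtr // addr_ge0 // sqr_ge0.
have D0 : 0 <= D by exact: sqrtr_ge0.
have [DE|Dn0] := eqVneq D 0.
  have := sqr_ge0 a; have := sqr_ge0 b; rewrite DE in D2 => b2 a2.
  have aE : a = 0 by apply/eqP; rewrite -sqrf_eq0; apply/eqP; lra.
  have bE : b = 0 by apply/eqP; rewrite -sqrf_eq0; apply/eqP; lra.
  by rewrite aE bE mulr0 c10 c20 -surjective_pairing.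
have Dp : 0 < D by rewrite lt_neqAle eq_sym Dn0.
pose c t := (c1 (t / D * a), c2 (t / D * b)).
have gc : geodesic (prod_dist d1 d2) c x y.
  split; rewrite /c -/D; first by rewrite !mul0r c10 c20 -surjective_pairing.
    by rewrite divff // !mul1r c11 c21 -surjective_pairing.
  have frac t : 0 <= t <= D -> 0 <= t / D <= 1.
    by move=> /andP[t0 tD]; rewrite divr_ge0 //= ler_pdivrMr // mul1r.
  move=> s t /frac s01 /frac t01; rewrite /prod_dist /= c1E ?c2E ?frac_bound //.
  rewrite !real_normK ?num_real // -sqrtr_sqr; congr Num.sqrt.
  have -> : (s - t) ^+ 2 = (s / D - t / D) ^+ 2 * D ^+ 2 by field.
  by rewrite D2; ring.
have := Cc _ _ _ Cx Cy gc (u * D); rewrite /c mulfK //; apply.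
exact: frac_bound.
Qed.

(** * Comparison of displacements in the two factors *)

Context (alpha : G) (C : set (X1 * X2)) (p : X1 * X2).
Context (Cinv : Defs.invariant rho C) (Cconv : convex (prod_dist d1 d2) C) (Cp : C p).
Context (Cqc : quotient_compact (prod_dist d1 d2) rho C).
Context (prop2 : proper_space d2) (pd2 : properly_discontinuous d2 rho2).
Context (ro1 : rank_one d1 (rho1 alpha)) (ro2 : rank_one d2 (rho2 alpha)).

Let l1 := transl_length d1 (rho1 alpha).
Let l2 := transl_length d2 (rho2 alpha).

(* In X2 the geodesic from the chosen translate [q.2] of [p.2] to [rho2 g p.2] must pass
   near [p.2]; there its partner in X1 is near [p.1], since [C] is cobounded and only
   finitely many group elements move [p.2] a bounded amount. *)
Lemma synchronized_passage : exists E, 0 <= E /\ forall (n : nat) g, exists q u,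
  [/\ 0 <= u <= 1, `|d1 q.1 p.1 - n%:R * l1| <= E, `|d2 q.2 p.2 - n%:R * l2| <= E,
      `|u * d1 q.1 (rho1 g p.1) - d1 q.1 p.1| <= E &
      `|u * d2 q.2 (rho2 g p.2) - d2 q.2 p.2| <= E].
Proof.
have [c1 [tau1 [cl1 _ l10 tl1 tr1]]] := rank_one_axis d1 HC1 rho1 act1 alpha ro1.
have [c2 [tau2 [cl2 [K [K0 con2]] l20 tl2 tr2]]] := rank_one_axis d2 HC2 rho2 act2 alpha ro2.
have [D cob] := quotient_compact_cobounded C p Cinv Cqc.
set e1 := d1 p.1 (c1 0); set e2 := d2 p.2 (c2 0); pose B := 3 * K + 2.
have e10 : 0 <= e1 := dist_ge0 d1 HC1 _ _; have e20 : 0 <= e2 := dist_ge0 d2 HC2 _ _.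
have [M [M0 HM]] := properly_discontinuous_bound p.1 p.2 (B + 2 * e2 + D) prop2 pd2.
have D0 : 0 < D by have [h [h1 _]] := cob p Cp; exact: le_lt_trans (dist_ge0 d1 HC1 _ _) h1.
exists (2 * e1 + 2 * e2 + B + D + M); split; first by rewrite /B; lra.
move=> n g; have [s0 ys0] := nearest_point_line d2 HC2 c2 cl2 (rho2 g p.2).
have [h [s [ss0 h2 d1h d2h]]] : exists h s, [/\ s * s0 <= 0, rho2 h (c2 0) = c2 s,
    d1 (rho1 h (c1 0)) (c1 0) = n%:R * l1 & d2 (rho2 h (c2 0)) (c2 0) = n%:R * l2].
  have [t1p t1m] := tr1 n; have [t2p t2m] := tr2 n.
  (* The sign decides between alpha^n and alpha^-n, so that [c2 0] lies between [c2 s] and the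
     projection of g p2. *)
  have [sg|sg] := leP (tau2 * s0) 0.
    exists (gpow alpha n), (n%:R * tau2); split => //.
    - by rewrite -mulrA mulr_ge0_le0.
    - by rewrite t1p cl1 subr0 normrM tl1 ger0_norm.
    - by rewrite t2p cl2 subr0 normrM tl2 ger0_norm.
  exists (gpow (inv alpha) n), (- (n%:R * tau2)); split => //.
  - by rewrite mulNr oppr_le0 -mulrA mulr_ge0 // ltW.
  - by rewrite t1m cl1 subr0 normrN normrM tl1 ger0_norm.
  - by rewrite t2m cl2 subr0 normrN normrM tl2 ger0_norm.
have i1 := action_iso d1 rho1 act1; have i2 := action_iso d2 rho2 act2.
have [sh gsh] := dist_geod d2 HC2 (c2 s) (rho2 g p.2).
have [u [u01 ub]] := geodesic_near_between d2 HC2 c2 cl2 K K0 con2 _ _ _ _ ss0 ys0 gsh.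
pose q := rho h p; exists q, u.
have [s1 gs1] := dist_geod d1 HC1 q.1 (rho1 g p.1).
have [s2 gs2] := dist_geod d2 HC2 q.2 (rho2 g p.2).
have Cm := convex_prod_geodesic C q (rho g p) s1 s2 u Cconv (Cinv h p Cp) (Cinv g p Cp) gs1 gs2 u01.
move: Cm; rewrite /= ; set m1 := s1 _; set m2 := s2 _ => Cm.
(* One [e2] pays for starting at q2 instead of [c2 s], the other for replacing [c2 0] by p2. *)
have m2p : d2 p.2 m2 <= B + 2 * e2.
  have := thin_end d2 HC2 _ _ _ _ _ u gsh gs2 u01; rewrite -/m2 -h2 /= i2 => t.
  rewrite h2 (dist_sym d2 HC2 (c2 0) p.2) -/e2 in t.
  have := dist_tri d2 HC2 p.2 (c2 0) m2.
  have := dist_tri d2 HC2 (c2 0) (sh (u * d2 (c2 s) (rho2 g p.2))) m2.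
  by rewrite -/e2 /B; lra.
have [k [k1 k2]] := cob _ Cm; rewrite /= in k1 k2.
(* The orbit point k p is within D of (m1, m2), so k moves p2 by at most [B + 2 * e2 + D] and hence
   p1 by at most M. *)
have m1p : d1 p.1 m1 <= D + M.
  have : d1 p.1 (rho1 k p.1) <= M.
    by apply: HM; have := dist_tri d2 HC2 p.2 m2 (rho2 k p.2); lra.
  have := dist_tri d1 HC1 p.1 (rho1 k p.1) m1; rewrite (dist_sym d1 HC1 (rho1 k p.1) m1); lra.
have := dist_translates_le d1 HC1 _ (i1 h) p.1 (c1 0); rewrite d1h -/e1 => a1.
have := dist_translates_le d2 HC2 _ (i2 h) p.2 (c2 0); rewrite d2h -/e2 => a2.
have v1 : 0 <= u * d1 q.1 (rho1 g p.1) <= d1 q.1 (rho1 g p.1) by rewrite frac_bound ?dist_ge0.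
have v2 : 0 <= u * d2 q.2 (rho2 g p.2) <= d2 q.2 (rho2 g p.2) by rewrite frac_bound ?dist_ge0.
have [w1 _] := geodesic_prefix d1 HC1 _ _ _ _ gs1 v1.
have [w2 _] := geodesic_prefix d2 HC2 _ _ _ _ gs2 v2.
have B0 : 0 <= B by rewrite /B; lra.
split => //.
- by apply: le_trans a1 _; lra.
- by apply: le_trans a2 _; lra.
(* The product with u is the distance from q to the intermediate point, so the error is at most the
   distance from that point to p. *)
- rewrite -{1}w1; apply: le_trans (dist_lip d1 HC1 _ _ _) _.
  by rewrite (dist_sym d1 HC1) -/m1; lra.
- rewrite -{1}w2; apply: le_trans (dist_lip d2 HC2 _ _ _) _.
  by rewrite (dist_sym d2 HC2) -/m2; lra.
Qed.

(** Eliminating u from N l1 ~ u a and N l2 ~ u b leaves an error 2E (a + b), where a, b are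
    distances from q to g p; replacing q by p costs an amount depending on N but not on g. *)
Lemma displacement_ratio : exists M, 0 <= M /\ forall n : nat, exists P, forall g,
  `|n%:R * (d1 p.1 (rho1 g p.1) * l2 - d2 p.2 (rho2 g p.2) * l1)| <=
    M * (d1 p.1 (rho1 g p.1) + d2 p.2 (rho2 g p.2)) + P.
Proof.
have [E [E0 HE]] := synchronized_passage.
have l10 : 0 <= l1 := ltW (hyperbolic_transl_length_gt0 d1 HC1 _ (proj1 ro1)).
have l20 : 0 <= l2 := ltW (hyperbolic_transl_length_gt0 d2 HC2 _ (proj1 ro2)).
exists (2 * E); split; first lra.
move=> n; set N := n%:R : R; have N0 : 0 <= N by rewrite ler0n.
exists (2 * E * (N * l1 + N * l2 + 2 * E) + N * (l2 * (N * l1 + E) + l1 * (N * l2 + E))) => g.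
have [q [u [u01 q1 q2 r1 r2]]] := HE n g; rewrite -/N in q1 q2.
have := dist_lip d1 HC1 (rho1 g p.1) q.1 p.1; have := dist_lip d2 HC2 (rho2 g p.2) q.2 p.2.
rewrite !(dist_sym d1 HC1 (rho1 g p.1)) !(dist_sym d2 HC2 (rho2 g p.2)).
set a := d1 q.1 _ in r1 *; set b := d2 q.2 _ in r2 *.
set a' := d1 p.1 _; set b' := d2 p.2 _ => bb aa.
have a0 : 0 <= a := dist_ge0 d1 HC1 _ _; have b0 : 0 <= b := dist_ge0 d2 HC2 _ _.
have a'0 : 0 <= a' := dist_ge0 d1 HC1 _ _; have b'0 : 0 <= b' := dist_ge0 d2 HC2 _ _.
have x1 : `|N * l1 - u * a| <= 2 * E.
  by move: q1 r1; rewrite !ler_norml => /andP[? ?] /andP[? ?]; apply/andP; split; lra.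
have x2 : `|N * l2 - u * b| <= 2 * E.
  by move: q2 r2; rewrite !ler_norml => /andP[? ?] /andP[? ?]; apply/andP; split; lra.
have x3 : `|a - a'| <= N * l1 + E.
  by apply: le_trans aa _; move: q1; rewrite ler_norml => /andP[? ?]; lra.
have x4 : `|b - b'| <= N * l2 + E.
  by apply: le_trans bb _; move: q2; rewrite ler_norml => /andP[? ?]; lra.
have -> : N * (a' * l2 - b' * l1) =
  (a * (N * l2 - u * b) - b * (N * l1 - u * a)) - (N * l2 * (a - a') - N * l1 * (b - b')) by ring.
apply: le_trans (ler_normB _ _) _.
have y1 : `|a * (N * l2 - u * b) - b * (N * l1 - u * a)| <= a * (2 * E) + b * (2 * E).
  apply: le_trans (ler_normB _ _) _; rewrite !normrM (ger0_norm a0) (ger0_norm b0).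
  by rewrite lerD // ler_wpM2l.
have y2 : `|N * l2 * (a - a') - N * l1 * (b - b')| <=
    N * l2 * (N * l1 + E) + N * l1 * (N * l2 + E).
  apply: le_trans (ler_normB _ _) _; rewrite !(normrM (N * _)) !(ger0_norm (mulr_ge0 N0 _)) //.
  by rewrite lerD // ler_wpM2l // mulr_ge0.
have y3 : (2 * E) * (a + b) <= (2 * E) * (a' + b' + N * l1 + N * l2 + 2 * E).
  apply: ler_wpM2l; first lra.
  by move: x3 x4; rewrite !ler_norml => /andP[? ?] /andP[? ?]; lra.
lra.
Qed.

End TwoActions.
End Actions.

(** * Proportionality of the length spectra *)

Theorem theorem1p2 (R : realType) (X1 X2 : Type)
  (d1 : X1 -> X1 -> R) (d2 : X2 -> X2 -> R)
  (G : Type) (mul : G -> G -> G) (inv : G -> G) (one : G)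
  (rho1 : G -> X1 -> X1) (rho2 : G -> X2 -> X2) :
  is_group mul inv one ->
  proper_CAT0 d1 -> proper_CAT0 d2 ->
  isometric_action mul one d1 rho1 -> isometric_action mul one d2 rho2 ->
  properly_discontinuous d1 rho1 -> properly_discontinuous d2 rho2 ->
  (exists alpha : G, rank_one d1 (rho1 alpha) /\ rank_one d2 (rho2 alpha)) ->
  convex_cocompact (prod_dist d1 d2) (fun g (p : X1 * X2) => (rho1 g p.1, rho2 g p.2)) ->
  exists lam : R, 0 < lam /\
    forall g : G, transl_length d1 (rho1 g) = lam * transl_length d2 (rho2 g).
Proof.
move=> HG [HC1 _] [HC2 prop2] act1 act2 _ pd2 [alpha [ro1 ro2]] [_ [C [[p Cp] _ Cinv Cconv Cqc]]].
have l10 := hyperbolic_transl_length_gt0 d1 HC1 _ (proj1 ro1).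
have l20 := hyperbolic_transl_length_gt0 d2 HC2 _ (proj1 ro2).
have [M [M0 HM]] := displacement_ratio mul inv one HG d1 d2 rho1 rho2 HC1 HC2 act1 act2
  alpha C p Cinv Cconv Cp Cqc prop2 pd2 ro1 ro2.
set l1 := transl_length d1 (rho1 alpha) in l10 HM.
set l2 := transl_length d2 (rho2 alpha) in l20 HM.
exists (l1 / l2); split=> [|g]; first exact: divr_gt0.
have ra := growth_rate_displacement mul one d1 HC1 rho1 act1 g p.1.
have rb := growth_rate_displacement mul one d2 HC2 rho2 act2 g p.2.
have l20n : l2 != 0 by rewrite gt_eqF.
(* Cleared of its denominator, the claim splits into two inequalities. Each applies the bound to
   g^(2^k), whose constant P does not depend on k. *)
apply: (mulIf l20n); rewrite mulrAC divfK // [RHS]mulrC; apply/le_anti/andP; split.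
  apply: growth_rate_cross_le (ltW l10) (ltW l20) M0 ra rb _ => n.
  have [P HP] := HM n; exists P => k.
  exact: le_trans (ler_norm _) (HP _).
apply: growth_rate_cross_le (ltW l20) (ltW l10) M0 rb ra _ => n.
have [P HP] := HM n; exists P => k.
by have := HP (gpow mul one g (2 ^ k)); rewrite -normrN => /(le_trans (ler_norm _)); lra.
Qed.
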